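(* Let $d,q\ge 1$, $m=2q$, and let $f$ be the symbol obtained by discretizing the elliptic problem $(-1)^q\sum_{i=1}^d \frac{\mathrm{d}^{2q}}{\mathrm{d}x_i^{2q}}u=g$ on $(0,1)^d$ by centered finite differences of precision order 2 and minimal bandwidth, so that $f$ has its unique zero in $[-\pi,\pi)^d$ at $x^0=0$. Let $p,r$ be trigonometric polynomials on $\mathbb{R}^d$, not identically zero, such that $P_n(p)=R_n(2^d r)^H$ (the restriction being $R_n(r)$), and let $\gamma_p$ and $\gamma_r$ be the high frequency orders of the prolongation $P_n(p)$ and of the restriction $R_n(r)$, respectively. Then the following two conditions are equivalent: (i) $\gamma_r+\gamma_p\ge m$; (ii) $\displaystyle \limsup_{x\to x^0}\left|\frac{p(y)^2}{f(x)}\right|<+\infty$ for all $y\in\mathcal{M}(x)$.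
   Context: Symbol of the discretization: using a uniform grid of the same meshsize $h$ in every direction, neglecting boundary effects (periodic boundary conditions), and moving the factor $1/h^{2q}$ to the right-hand side, the coefficient matrix is the $d$-level circulant matrix $\mathcal{C}_n(f)$ with $f(x)=\sum_{j=1}^d(2-2\cos x_j)^q$. This $f$ vanishes at the origin with order $2q$. Circulant matrices: for $n=(n_1,\dots,n_d)=2^a$ (componentwise), $a\in\mathbb{N}^d$ with all $a_i\ge1$, and $f$ a function on $\mathbb{R}^d$ that is $2\pi$-periodic in each variable, $\mathcal{C}_n(f)=F_n D F_n^H$, where $F_n=F_{n_1}\otimes\cdots\otimes F_{n_d}$, $F_{n_i}=\frac1{\sqrt{n_i}}\left[e^{-\mathrm{i}\,2\pi st/n_i}\right]_{s,t=0}^{n_i-1}$, and $D$ is the diagonal matrix of the values $f(2\pi j_1/n_1,\dots,2\pi j_d/n_d)$, $0\le j_i\le n_i-1$, in the corresponding order. Grid transfer operators: $K_n=K_{n_1}\otimes\cdots\otimes K_{n_d}$, where $K_{n_i}\in\mathbb{R}^{(n_i/2)\times n_i}$ is the down-sampling matrix with entry $1$ in row $k$ and column $2k-1$ for $k=1,\dots,n_i/2$ and $0$ elsewhere. Restriction: $R_n(r)=K_n\mathcal{C}_n(r)$. Prolongation: $P_n(p)=\mathcal{C}_n(p)K_n^T$. The identity $P_n(p)=R_n(2^dr)^H$ is required for all such $n$. Mirror points: $\Omega(x)=\{y : y_j\in\{x_j,\pi+x_j\},\ j=1,\dots,d\}$ and $\mathcal{M}(x)=\Omega(x)\setminus\{x\}$.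 ''For all $y\in\mathcal{M}(x)$'' in a limit in $x$ means: for each of the $2^d-1$ choices $y=x+\pi\varepsilon$, $\varepsilon\in\{0,1\}^d\setminus\{0\}$, kept fixed as $x$ varies. High frequency order: write a grid transfer operator as $B_n(g)$, where $B_n(g)=R_n(g)$ for a restriction and $B_n(g)=P_n(2^dg)$ for a prolongation. The high frequency order (HF) of $B_n(g)$ is the largest $s\ge0$ such that $g(y)=O(|x|^s)$ as $|x|\to0$ for all $y\in\mathcal{M}(x)$, where $|x|=\max_i|x_i|$. *)

(* Defs.v *)
From HB Require Import structures.
From mathcomp Require Import all_boot all_order all_algebra.
From mathcomp Require Import spectral.
From mathcomp Require Import all_classical all_reals all_analysis.
From mathcomp Require Import complex mxtens.

Set Implicit Arguments.
Unset Strict Implicit.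
Unset Printing Implicit Defensive.

Import Order.TTheory GRing.Theory Num.Theory.
Import numFieldNormedType.Exports.

Local Open Scope classical_set_scope.
Local Open Scope ring_scope.
Local Open Scope complex_scope.
Local Open Scope sesquilinear_scope.

Definition cis (R : realType) (t : R) : R[i] := cos t +i* sin t.

Definition trigpoly (R : realType) (d : nat) (g : 'rV[R]_d -> R[i]) : Prop :=
  exists s : seq (R[i] * 'rV[int]_d), forall x,
    g x = \sum_(t <- s) t.1 * cis (\sum_(j < d) (t.2 0 j)%:~R * x 0 j).

Definition elliptic_symbol (R : realType) (d q : nat) (x : 'rV[R]_d) : R :=
  \sum_(j < d) (2 - 2 * cos (x 0 j)) ^+ q.

(* A d-level matrix is attached to the list n = [:: n_1; ...; n_d] of its level
   sizes; [levels sz n] is the product of the [sz n_i]. *)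
Fixpoint levels (sz : nat -> nat) (n : seq nat) : nat :=
  if n is k :: n' then (sz k * levels sz n')%N else 1%N.

(* A_(n_1) (x) (A_(n_2) (x) ( ... (x) A_(n_d))) *)
Fixpoint kron (C : comNzRingType) (rows cols : nat -> nat)
    (A : forall k, 'M[C]_(rows k, cols k)) (n : seq nat) :
    'M[C]_(levels rows n, levels cols n) :=
  if n is k :: n' then A k *t kron A n' else 1%:M.

(* The multi-index (j_1, ..., j_d), 0 <= j_i < n_i, which labels row i of a
   Kronecker product of matrices of sizes n_1, ..., n_d. *)
Fixpoint multi_index (n : seq nat) : 'I_(levels id n) -> seq nat :=
  if n is k :: n' then
    fun i => let u := @mxtens_unindex k (levels id n') i in
             nat_of_ord u.1 :: multi_index u.2
  else fun=> [::].

Definition grid_point (R : realType) (d : nat) (n : seq nat)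
    (i : 'I_(levels id n)) : 'rV[R]_d :=
  \row_(k < d) (2 * pi * (nth 0%N (multi_index i) k)%:R / (nth 0%N n k)%:R).

Definition fourier1 (R : realType) (n : nat) : 'M[R[i]]_(id n, id n) :=
  \matrix_(s, t) (((Num.sqrt n%:R)^-1)%:C * cis (- (2 * pi * s%:R * t%:R / n%:R))).

Definition fourier (R : realType) (n : seq nat) : 'M[R[i]]_(levels id n) :=
  kron (@fourier1 R) n.

Definition circulant (R : realType) (d : nat) (n : seq nat)
    (g : 'rV[R]_d -> R[i]) : 'M[R[i]]_(levels id n) :=
  fourier R n *m diag_mx (\row_i g (grid_point R d i)) *m (fourier R n)^t*.

(* With indices starting from 0, row k of the down-sampling matrix selects
   column 2k. *)
Definition cut1 (R : realType) (n : nat) : 'M[R[i]]_(half n, id n) :=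
  \matrix_(k, l) (nat_of_ord l == k.*2)%:R.

Definition cut (R : realType) (n : seq nat) :
    'M[R[i]]_(levels half n, levels id n) :=
  kron (@cut1 R) n.

Definition restriction (R : realType) (d : nat) (n : seq nat)
    (r : 'rV[R]_d -> R[i]) : 'M[R[i]]_(levels half n, levels id n) :=
  cut R n *m circulant n r.

Definition prolongation (R : realType) (d : nat) (n : seq nat)
    (p : 'rV[R]_d -> R[i]) : 'M[R[i]]_(levels id n, levels half n) :=
  circulant n p *m (cut R n)^T.

(* The point x + pi * e of Omega(x); it is a mirror point of x, i.e. it lies in
   M(x), exactly when e has a nonzero entry. *)
Definition mirror (R : realType) (d : nat) (e : 'I_d -> bool) (x : 'rV[R]_d) :
    'rV[R]_d :=
  \row_(j < d) (x 0 j + (if e j then pi else 0)).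

(* The real numbers s >= 0 such that g(y) = O(|x|^s) as |x| -> 0 for every
   mirror point y of x; `|x| is the max norm of the row vector x. *)
Definition hf_orders (R : realType) (d : nat) (g : 'rV[R]_d -> R[i]) : set R :=
  [set s : R | 0 <= s /\
    forall e : 'I_d -> bool, (exists j, e j) ->
      (fun x : 'rV[R]_d => Normc.normc (g (mirror e x)))
        =O_ ((0 : 'rV[R]_d)^') (fun x : 'rV[R]_d => `|x| `^ s)].

Definition largest (R : realType) (A : set R) (m : R) : Prop :=
  A m /\ ubound A m.

Definition hf_restriction (R : realType) (d : nat) (r : 'rV[R]_d -> R[i])
    (s : R) : Prop :=
  largest (hf_orders r) s.

(* The high frequency order of B(g) = P(2^d g) is read off g, so for P(p) the
   relevant function is g = p / 2^d. *)
Definition hf_prolongation (R : realType) (d : nat) (p : 'rV[R]_d -> R[i])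
    (s : R) : Prop :=
  largest (hf_orders (fun x => p x / 2 ^+ d)) s.

(* Main.v *)
Require Import Defs.
From HB Require Import structures.
From mathcomp Require Import all_boot all_order all_algebra.
From mathcomp Require Import spectral.
From mathcomp Require Import all_classical all_reals all_analysis.
From mathcomp Require Import complex mxtens.
From mathcomp Require Import ring lra.

Import Order.TTheory GRing.Theory Num.Theory.
Import numFieldNormedType.Exports.

Local Open Scope classical_set_scope.
Local Open Scope ring_scope.
Local Open Scope complex_scope.
Local Open Scope sesquilinear_scope.

(** The adjoint of a circulant matrix has the conjugate symbol, so [C_n(p) K_n^T]
    and [(K_n C_n(2^d r))^H] are both obtained from a circulant matrix by keeping
    the same columns. A circulant matrix is determined by any one of its columns,
    hence [p] and the conjugate of [2^d r] agree on every grid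
    ([prolongation_adjoint_grid]). The grid points become dense modulo the
    periods, and trigonometric polynomials are continuous and periodic, so
    [p = 2^d conj r] everywhere ([prolongation_adjoint_symbol]).

    Therefore [|p / 2^d| = |r|]: the two operators have the same high frequency
    order, say gamma, and (i) reads [q <= gamma]. On the other side f is bounded
    above and below by multiples of [|x|^(2q)] near 0
    ([elliptic_symbol_equiv], a consequence of [sin u / u --> 1]), so (ii) says
    that [|p(y)| = O(|x|^q)] at all the mirror points y, that is, that q is one
    of the exponents of which gamma is the largest ([hf_orders_limsup]). These
    exponents are closed under taking smaller nonnegative numbers
    ([hf_orders_le]), so this too amounts to [q <= gamma]. *)

(** * Kronecker products over a list of level sizes *)

Lemma eq_kron (C : comNzRingType) (rows cols : nat -> nat)
    (A B : forall k, 'M[C]_(rows k, cols k)) (n : seq nat) :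
  (forall k, k \in n -> A k = B k) -> kron A n = kron B n.
Proof.
elim: n => //= k n IHn AB; rewrite AB ?mem_head// IHn// => l ln.
by apply: AB; rewrite in_cons ln orbT.
Qed.

Lemma mulmx_kron (C : comNzRingType) (rows mids cols : nat -> nat)
    (A : forall k, 'M[C]_(rows k, mids k)) (B : forall k, 'M[C]_(mids k, cols k))
    (n : seq nat) :
  kron A n *m kron B n = kron (fun k => A k *m B k) n.
Proof. by elim: n => /= [|k n IHn]; rewrite ?mul1mx// tensmx_mul IHn. Qed.

Lemma trmx_kron (C : comNzRingType) (rows cols : nat -> nat)
    (A : forall k, 'M[C]_(rows k, cols k)) (n : seq nat) :
  (kron A n)^T = kron (fun k => (A k)^T) n.
Proof. by elim: n => /= [|k n IHn]; rewrite ?trmx1// trmx_tens IHn. Qed.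

Lemma map_kron (C D : comNzRingType) (f : {rmorphism C -> D})
    (rows cols : nat -> nat) (A : forall k, 'M[C]_(rows k, cols k)) (n : seq nat) :
  map_mx f (kron A n) = kron (fun k => map_mx f (A k)) n.
Proof. by elim: n => /= [|k n IHn]; rewrite ?map_mx1// map_mxT IHn. Qed.

Lemma kron1 (C : comNzRingType) (n : seq nat) :
  kron (fun k => 1%:M : 'M[C]_(id k)) n = 1%:M.
Proof.
elim: n => //= k n ->.
apply/matrixP => i j; case/(@mxtens_indexP k (levels id n)): i => i1 i2.
case/(@mxtens_indexP k (levels id n)): j => j1 j2.
rewrite tensmxE !mxE (can_eq (@mxtens_indexK k (levels id n))) xpair_eqE.
by rewrite -natrM mulnb.
Qed.

(** The columns of a Kronecker product are the Kronecker products of columns of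
    the factors, so a column without zero entries in each factor gives one in
    the product. *)
Lemma kron_col_neq0 (C : fieldType) (rows cols : nat -> nat)
    (A : forall k, 'M[C]_(rows k, cols k)) (n : seq nat) :
  (forall k, k \in n -> exists j, forall i, A k i j != 0) ->
  exists j, forall i, kron A n i j != 0.
Proof.
elim: n => [|k n IHn] A0 /=.
  by exists ord0 => i; rewrite !ord1 mxE oner_neq0.
have [j1 j1P] := A0 k (mem_head _ _).
have [l ln|j2 j2P] := IHn; first by apply: A0; rewrite in_cons ln orbT.
exists (mxtens_index (j1, j2)) => i.
case/(@mxtens_indexP (rows k) (levels rows n)): i => i1 i2.
by rewrite tensmxE mulf_neq0.
Qed.

(** * Roots of unity and the Fourier matrix *)

Section cis.
Context {R : realType}.
Implicit Types s t : R.

Lemma cis0 : cis 0 = 1 :> R[i].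
Proof. by rewrite /cis cos0 sin0. Qed.

Lemma cisD s t : cis (s + t) = cis s * cis t.
Proof.
by rewrite /cis cosD sinD; apply/eqP; rewrite eq_complex /= addrC eqxx/= addrC.
Qed.

Lemma cisMn t n : cis (t *+ n) = cis t ^+ n.
Proof. by elim: n => [|n IHn]; rewrite ?cis0// mulrS exprS cisD IHn. Qed.

Lemma conj_cis t : (cis t)^* = cis (- t).
Proof. by rewrite /cis cosN sinN. Qed.

Lemma cis2pi : cis (2 * pi) = 1 :> R[i].
Proof. by rewrite mulrC mulr_natr /cis cos2pi sin2pi. Qed.

Lemma cis2piz (z : int) : cis (2 * pi * z%:~R) = 1 :> R[i].
Proof.
case: z => n.
  by rewrite mulr_natr cisMn cis2pi expr1n.
by rewrite NegzE mulrNz mulrN -conj_cis mulr_natr cisMn cis2pi expr1n rmorph1.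
Qed.

(** [cos t = 1 - 2 sin(t / 2)^2], and the sine is positive on [(0, pi)]. *)
Lemma cis_neq1 t : 0 < t < 2 * pi -> cis t != 1.
Proof.
move=> /andP[t0 tpi]; apply/negP; rewrite eq_complex /= => /andP[/eqP + _].
have -> : t = (t / 2) *+ 2 by rewrite -mulr_natr mulfVK.
have s0 : 0 < sin (t / 2) by apply: sin_gt0_pi; lra.
rewrite cos_mulr2n cos2sin2 => h.
by have := exprn_gt0 2 s0; lra.
Qed.

Lemma normc_conjc (z : R[i]) : Normc.normc (z^*) = Normc.normc z.
Proof. by case: z => a b /=; rewrite sqrrN. Qed.
End cis.

(** The entry (s, t) is the mean of the powers of
    [w = exp(2 i pi (s - t) / k)]; since [w ^ k = 1], this geometric sum vanishes
    unless [w = 1], which happens only for [s = t]. *)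
Lemma fourier1_unitary (R : realType) (k : nat) : (0 < k)%N ->
  (fourier1 R k)^t* *m fourier1 R k = 1%:M.
Proof.
move=> k0; have kn0 : k%:R != 0 :> R by rewrite pnatr_eq0 -lt0n.
apply/matrixP => s t; rewrite !mxE.
pose w : R[i] := cis (2 * pi * (s%:R - t%:R) / k%:R).
rewrite (eq_bigr (fun u : 'I_k => (k%:R^-1)%:C * w ^+ u)); last first.
  move=> u _; rewrite !mxE rmorphM /= [X in X * _](_ : _ =
    (Num.sqrt k%:R)^-1%:C * cis (2 * pi * u%:R * s%:R / k%:R)); last first.
    rewrite -[Num.conj _]/((_)^*%C) -[Num.conj _]/((_)^*%C).
    by rewrite conj_cis opprK conjc_real.
  rewrite mulrACA -rmorphM /= -invfM -expr2 sqr_sqrtr ?ler0n// -cisD -cisMn.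
  by congr (_ * cis _); rewrite -mulr_natr; field.
rewrite -big_distrr /=.
have wk : w ^+ k = 1.
  rewrite /w -cisMn -[X in cis X]mulr_natr divfK//.
  have -> : s%:R - t%:R = (s%:Z - t%:Z)%:~R :> R by rewrite rmorphB.
  exact: cis2piz.
have [st|st] := eqVneq s t.
  rewrite (eq_bigr (fun=> 1)) => [|u _]; last first.
    by rewrite /w st subrr mulr0 mul0r cis0 expr1n.
  by rewrite sumr_const card_ord -(rmorph_nat (real_complex R)) -rmorphM /= mulVf.
have w1 : w != 1.
  have k0' : 0 < k%:R :> R by rewrite ltr0n.
  have pi0 : 0 < 2 * pi :> R by rewrite mulr_gt0// pi_gt0.
  have main (a b : 'I_k) : (b < a)%N -> cis (2 * pi * (a%:R - b%:R) / k%:R) != 1 :> R[i].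
    move=> ba; apply: cis_neq1; rewrite -mulrA pmulr_rgt0// divr_gt0//=; last first.
      by rewrite subr_gt0 ltr_nat.
    rewrite gtr_pMr// ltr_pdivrMr// mul1r ltrBlDr -natrD ltr_nat.
    by rewrite (leq_trans (ltn_ord a))// leq_addr.
  move: st; rewrite neq_ltn => /orP[|] h; last exact: main.
  (* Conjugation exchanges s and t. *)
  rewrite -(inj_eq (can_inj (@conjcK R))) rmorph1.
  rewrite -/(conjc w) conj_cis -mulNr -mulrN opprB; exact: main.
have : (w - 1) * \sum_(u < k) w ^+ u = 0 by rewrite -subrX1 wk subrr.
by move/eqP; rewrite mulf_eq0 subr_eq0 (negPf w1) /= => /eqP ->; rewrite mulr0.
Qed.

(** * Equality of the symbols on the grids *)

Lemma fourier_unitary (R : realType) (n : seq nat) :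
  (forall k, k \in n -> (0 < k)%N) -> (fourier R n)^t* *m fourier R n = 1%:M.
Proof.
move=> n0; rewrite /fourier trmx_kron map_kron mulmx_kron -kron1.
by apply: eq_kron => k kn; apply/fourier1_unitary/n0.
Qed.

Lemma conj_cut (R : realType) (n : seq nat) : (Defs.cut R n)^t* = (Defs.cut R n)^T.
Proof.
rewrite /Defs.cut trmx_kron map_kron; apply: eq_kron => k _.
by apply/matrixP => i j; rewrite !mxE rmorph_nat.
Qed.

(** The down-sampling keeps the grid node 0, and the column of [F_n^H] at that
    node is constant and nonzero. *)
Lemma fourier_cut_col_neq0 (R : realType) (n : seq nat) :
  (forall k, k \in n -> (1 < k)%N) ->
  exists j, forall i, ((fourier R n)^t* *m (Defs.cut R n)^T) i j != 0.
Proof.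
move=> n1; rewrite /fourier /Defs.cut !trmx_kron map_kron mulmx_kron.
apply: kron_col_neq0 => k /n1 k1.
have hk : (0 < half k)%N by rewrite half_gt0.
exists (Ordinal hk) => i; rewrite mxE.
rewrite (bigD1 (Ordinal (ltnW k1)))//= big1 ?addr0 => [|l l0]; last first.
  by rewrite !mxE /= (_ : (l == 0 :> nat) = false) ?mulr0//; exact/negbTE.
rewrite !mxE /= mulr1 fmorph_eq0 mulf_neq0//.
  by rewrite fmorph_eq0 invr_eq0 sqrtr_eq0 -ltNge ltr0n ltnW.
by rewrite mulr0 !mul0r oppr0 cis0 oner_neq0.
Qed.

(** Cancelling the unitary [F_n] from [P_n(p) - R_n(r)^H = 0] leaves
    [D F_n^H K_n^T = 0], where the diagonal of D carries the values of
    [p - conj r]; one column without zero entries then forces D = 0. *)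
Lemma prolongation_adjoint_grid (R : realType) (d : nat) (n : seq nat)
    (p r : 'rV[R]_d -> R[i]) :
  (forall k, k \in n -> (1 < k)%N) ->
  prolongation n p = (restriction n r)^t* ->
  forall i : 'I_(levels id n), p (grid_point R d i) = (r (grid_point R d i))^*.
Proof.
move=> n1; rewrite /prolongation /restriction /circulant.
have adjM m k l (A : 'M[R[i]]_(m, k)) (B : 'M[R[i]]_(k, l)) :
    (A *m B)^t* = B^t* *m A^t* by rewrite trmx_mul map_mxM.
rewrite !adjM trmxCK conj_cut tr_diag_mx map_diag_mx -!mulmxA.
move=> /(congr1 (mulmx ((fourier R n)^t*))).
rewrite !(mulmxA ((fourier R n)^t*)) fourier_unitary ?mul1mx; last first.
  by move=> k /n1 /ltnW.
have [j jP] := @fourier_cut_col_neq0 R n n1.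
move=> /matrixP E i; have := E i j; rewrite !mul_diag_mx !mxE.
by move: (jP i); rewrite !mxE => jPi /(mulIf jPi).
Qed.

Lemma multi_index_surj (n j : seq nat) :
  all2 ltn j n -> exists i : 'I_(levels id n), multi_index i = j.
Proof.
elim: n j => [|k n IHn] [|l j] //= => [_|/andP[lk /IHn[i <-]]].
  by exists ord0.
exists (mxtens_index (Ordinal lk, i)).
have e := @mxtens_indexK k (levels id n) (Ordinal lk, i).
pose F (u : 'I_k * 'I_(levels id n)) := (u.1 : nat) :: multi_index u.2.
by have := congr1 F e; rewrite /F /= => ->.
Qed.

(** * Equality of the symbols everywhere *)

Lemma continuous_sum (T : topologicalType) (R : realType) (I : Type)
    (s : seq I) (F : I -> T -> R) :
  (forall i, continuous (F i)) -> continuous (fun x => \sum_(i <- s) F i x).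
Proof.
move=> cF x; elim: s => [|i s IHs].
  by under eq_fun do rewrite big_nil; exact: cvg_cst.
under eq_fun do rewrite big_cons.
by apply: cvgD; [exact: cF|exact: IHs].
Qed.

Section trigpoly.
Context {R : realType} {d : nat}.
Implicit Types (g : 'rV[R]_d -> R[i]) (x : 'rV[R]_d).

Lemma trigpolyZ (c : R[i]) g : trigpoly g -> trigpoly (fun x => c * g x).
Proof.
move=> [s gs]; exists [seq (c * t.1, t.2) | t <- s] => x.
rewrite gs big_map big_distrr /=.
by apply: eq_bigr => t _; rewrite mulrA.
Qed.

Lemma trigpoly_periodic g (z : 'I_d -> int) x :
  trigpoly g -> g (\row_k (x 0 k + 2 * pi * (z k)%:~R)) = g x.
Proof.
move=> [s gs]; rewrite !gs; apply: eq_bigr => t _; congr (_ * _).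
under eq_bigr do rewrite mxE mulrDr.
rewrite big_split cisD /= -[RHS]mulr1; congr (_ * _).
rewrite (eq_bigr (fun j => 2 * pi * (t.2 0 j * z j)%:~R)) => [|j _]; last first.
  by rewrite mulrCA intrM.
by rewrite -mulr_sumr -rmorph_sum cis2piz.
Qed.

Lemma trigpoly_continuous_ReIm g : trigpoly g ->
  continuous (fun x => complex.Re (g x)) /\ continuous (fun x => complex.Im (g x)).
Proof.
move=> [s gs].
have cmul (a : R) (f : 'rV[R]_d -> R) :
    continuous f -> continuous (fun x => a * f x).
  move=> cf x; apply: (@continuousM _ _ (fun=> a) f); last exact: cf.
  exact: cst_continuous.
have cadd (f1 f2 : 'rV[R]_d -> R) : continuous f1 -> continuous f2 ->
    continuous (fun x => f1 x + f2 x).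
  by move=> c1 c2 x; apply: (@continuousD _ _ _ f1 f2); [exact: c1|exact: c2].
have ctheta (l : 'rV[int]_d) :
    continuous (fun x => \sum_(j < d) (l 0 j)%:~R * x 0 j : R).
  apply: continuous_sum => j; apply: (cmul _ (fun x => x 0 j)).
  exact: coord_continuous.
have ccos (l : 'rV[int]_d) :
    continuous (fun x => cos (\sum_(j < d) (l 0 j)%:~R * x 0 j : R)).
  move=> x; apply: (@continuous_comp _ _ _ _ (@cos R)) => //; first exact: ctheta.
  exact: continuous_cos.
have csin (l : 'rV[int]_d) :
    continuous (fun x => sin (\sum_(j < d) (l 0 j)%:~R * x 0 j : R)).
  move=> x; apply: (@continuous_comp _ _ _ _ (@sin R)) => //; first exact: ctheta.
  exact: continuous_sin.
split.
- rewrite [F in continuous F](_ : _ = fun x => \sum_(t <- s)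
    (complex.Re t.1 * cos (\sum_(j < d) (t.2 0 j)%:~R * x 0 j)
    - complex.Im t.1 * sin (\sum_(j < d) (t.2 0 j)%:~R * x 0 j))).
    apply: continuous_sum => t; apply: cadd; first exact: cmul.
    by under eq_fun do rewrite -mulNr; exact: cmul.
  apply/funext => x /=; rewrite gs raddf_sum; apply: eq_bigr => t _.
  by case: t.1.
- rewrite [F in continuous F](_ : _ = fun x => \sum_(t <- s)
    (complex.Re t.1 * sin (\sum_(j < d) (t.2 0 j)%:~R * x 0 j)
    + complex.Im t.1 * cos (\sum_(j < d) (t.2 0 j)%:~R * x 0 j))).
    by apply: continuous_sum => t; apply: cadd; exact: cmul.
  apply/funext => x /=; rewrite gs raddf_sum; apply: eq_bigr => t _.
  by case: t.1.
Qed.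

(** Rounding the coordinates down to multiples of [2 pi / 2 ^ m], for m large,
    and reducing the multiples modulo [2 ^ m] lands on a grid point. *)
Lemma dyadic_approx x (e : R) : 0 < e -> exists (m : nat) (z : 'I_d -> int)
    (i : 'I_(levels id (nseq d (2 ^ m.+1)%N))),
  ball x e (\row_k (grid_point R d i 0 k + 2 * pi * (z k)%:~R)).
Proof.
move=> e0; have pi2 : 0 < 2 * pi :> R by rewrite mulr_gt0// pi_gt0.
have [m me] : exists m, 2 * pi / 2 ^+ m.+1 < e.
  have := @cvg_geometric R (2 * pi) 2^-1; rewrite ger0_norm// invf_lt1// ltr1n.
  move=> /(_ isT)/cvgr0Pnorm_lt/(_ _ e0)[N _ /(_ N.+1)/=].
  rewrite exprVn ger0_norm ?divr_ge0 ?(ltW pi2) ?exprn_ge0// => h.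
  by exists N; apply: h.
pose M := (2 ^ m.+1)%N; have M0 : (0 < M)%N by rewrite expn_gt0.
have MR : 0 < M%:R :> R by rewrite ltr0n.
have MZ : M%:Z != 0 by rewrite -lt0n.
pose a (k : 'I_d) : int := Num.floor (x 0 k * M%:R / (2 * pi)).
(* The index is extended by 0 to all of [nat], to be listed by [mkseq]. *)
pose j (k : nat) : nat := if insub k is Some k' then `|(a k' %% M)%Z|%N else 0%N.
have jE (k : 'I_d) : (j k)%:Z = (a k %% M)%Z.
  by rewrite /j valK gez0_abs ?modz_ge0.
have jM (k : 'I_d) : (j k < M)%N by rewrite -ltz_nat jE ltz_pmod.
have [|i ij] := @multi_index_surj (nseq d M) (mkseq j d).
  rewrite all2E size_mkseq size_nseq eqxx /=; apply/(all_nthP (0%N, 0%N)) => k.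
  rewrite size_zip size_mkseq size_nseq minnn => kd.
  rewrite nth_zip ?size_mkseq ?size_nseq//= nth_mkseq// nth_nseq kd.
  exact: (jM (Ordinal kd)).
exists m, (fun k => (a k %/ M)%Z), i; split=> // u k.
rewrite !mxE ord1 ij nth_mkseq// nth_nseq ltn_ord.
have -> : 2 * pi * (j k)%:R / M%:R + 2 * pi * (a k %/ M)%Z%:~R
    = 2 * pi / M%:R * (a k)%:~R :> R.
  rewrite [in RHS](divz_eq (a k) M) -jE intrD intrM /=.
  by field; rewrite gt_eqF.
have /andP[] := floor_itv (x 0 k * M%:R / (2 * pi)).
rewrite -/(a k) intrD ler_pdivlMr// ltr_pdivrMr// => h1 h2.
apply: le_lt_trans me; rewrite -natrX -/M.
rewrite -(ler_pM2r MR) -[X in _ * X](gtr0_norm MR) -normrM divfK ?gt_eqF//.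
rewrite mulrBl [X in _ - X]mulrAC divfK ?gt_eqF//.
by rewrite ler_norml; apply/andP; split; lra.
Qed.

(** The grids with equal level sizes already suffice: translated by the periods,
    their points are dense, and the real and imaginary parts of [p - conj r] are
    continuous. *)
Lemma prolongation_adjoint_symbol (p r : 'rV[R]_d -> R[i]) :
  trigpoly p -> trigpoly r ->
  (forall m, let n := nseq d (2 ^ m.+1)%N in
     prolongation n p = (restriction n r)^t*) ->
  forall x, p x = (r x)^*.
Proof.
move=> tp tr pr x.
have [cRp cIp] := trigpoly_continuous_ReIm _ tp.
have [cRr cIr] := trigpoly_continuous_ReIm _ tr.
have grid (m : nat) (z : 'I_d -> int) (i : 'I_(levels id (nseq d (2 ^ m.+1)%N))) :
    p (\row_k (grid_point R d i 0 k + 2 * pi * (z k)%:~R)) =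
    (r (\row_k (grid_point R d i 0 k + 2 * pi * (z k)%:~R)))^*.
  rewrite !trigpoly_periodic//; apply: (prolongation_adjoint_grid _ _ _ _ _ _ (pr m) i).
  by move=> k /nseqP[-> _]; rewrite -[1%N]/(2 ^ 0)%N ltn_exp2l.
have closed_grid (u : 'rV[R]_d -> R) : continuous u ->
    (forall y, p y = (r y)^* -> u y = 0) -> u x = 0.
  move=> cu u0; apply/eqP/negPn/negP => ux.
  have := cu x; move/cvgrPdist_lt => /(_ `|u x|); rewrite normr_gt0 => /(_ ux).
  move=> /nbhs_ballP[e /= e0 ue].
  have [m [z [i xi]]] := dyadic_approx x _ e0.
  by have := ue _ xi; rewrite /= (u0 _ (grid m z i)) subr0 ltxx.
apply/eqP; rewrite eq_complex; apply/andP; split; rewrite -subr_eq0; apply/eqP.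
- rewrite (_ : complex.Re ((r x)^*) = complex.Re (r x)); last by case: (r x).
  apply: (closed_grid (fun y => complex.Re (p y) - complex.Re (r y))).
    by move=> y; apply: (@continuousB _ _ _ (fun y => complex.Re (p y)));
       [exact: cRp|exact: cRr].
  by move=> y ->; case: (r y) => a b /=; rewrite subrr.
- rewrite (_ : complex.Im ((r x)^*) = - complex.Im (r x)); last by case: (r x).
  rewrite opprK; apply: (closed_grid (fun y => complex.Im (p y) + complex.Im (r y))).
    by move=> y; apply: (@continuousD _ _ _ (fun y => complex.Im (p y)));
       [exact: cIp|exact: cIr].
  by move=> y ->; case: (r y) => a b /=; rewrite addNr.
Qed.
End trigpoly.

(** * Growth of the elliptic symbol at the origin *)

(** The quotient [sin t / t] tends to the derivative of sin at 0, which is 1. *)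
Lemma sin_equiv (R : realType) : exists2 e : R, 0 < e &
  forall t, `|t| < e -> `|t| / 2 <= `|sin t| <= 2 * `|t|.
Proof.
have dsin : h^-1 *: sin h @[h --> (0 : R)^'] --> (1 : R).
  have [ds Ds] := is_derive_sin (0 : R); rewrite cos0 in Ds.
  rewrite -[1]Ds.
  suff -> : (fun h : R => h^-1 *: sin h) =
      (fun h => h^-1 *: ((sin \o shift 0) (h *: 1) - sin 0)) by exact: ds.
  by apply/funext => h /=; rewrite addr0 sin0 subr0 /GRing.scale /= mulr1.
have h2 : 0 < 2^-1 :> R by rewrite invr_gt0.
move/cvgrPdist_lt : dsin => /(_ _ h2).
rewrite /dnbhs /within /= near_withinE.
move=> /nbhs_ballP[e /= e0 he]; exists e => // t te.
have [->|t0] := eqVneq t 0; first by rewrite sin0 normr0 mul0r mulr0 lexx.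
have := he t; rewrite /ball /= sub0r normrN => /(_ te t0).
have tn : 0 < `|t| by rewrite normr_gt0.
set w := (t^-1 *: _) => hw.
have -> : sin t = t * w by rewrite /w /GRing.scale /= mulrA divff// mul1r.
rewrite normrM.
have : 2^-1 <= `|w| <= 2.
  move: hw; rewrite ltr_norml => /andP[h3 h4]; rewrite ger0_norm; lra.
move=> /andP[w1 w2]; apply/andP; split; first by rewrite ler_pM2l.
by rewrite [leRHS]mulrC ler_pM2l.
Qed.

(** [2 - 2 cos t = (2 sin (t / 2))^2]. *)
Lemma two_sub_2cos_equiv (R : realType) : exists2 e : R, 0 < e &
  forall t, `|t| < e -> t ^+ 2 / 4 <= 2 - 2 * cos t <= 4 * t ^+ 2.
Proof.
have [e e0 sine] := sin_equiv R; exists e => // t te.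
have ht : `|t / 2| = `|t| / 2 by rewrite normrM [`|2^-1|]gtr0_norm// invr_gt0.
have /sine : `|t / 2| < e.
  by rewrite ht (le_lt_trans _ te)// ler_pdivrMr// ler_peMr// ler1n.
rewrite ht -(real_normK (num_real t)).
have -> : 2 - 2 * cos t = 4 * `|sin (t / 2)| ^+ 2.
  have -> : cos t = cos ((t / 2) *+ 2) by rewrite -mulr_natr divfK.
  by rewrite cos_mulr2n real_normK ?num_real// sin2cos2; ring.
have := normr_ge0 t; have := normr_ge0 (sin (t / 2)).
move: `|t| `|sin _| => a b b0 a0 /andP[h1 h2].
by apply/andP; split; nra.
Qed.

Lemma elliptic_symbol_ge0 (R : realType) (d q : nat) (x : 'rV[R]_d) :
  0 <= elliptic_symbol q x.
Proof.
apply: sumr_ge0 => j _; apply: exprn_ge0.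
by have := cos_le1 (x 0 j); lra.
Qed.

Lemma coord_le_norm (R : realType) (d : nat) (x : 'rV[R]_d) (j : 'I_d) :
  `|x 0 j| <= `|x|.
Proof.
rewrite [leRHS]/Num.norm /= mx_normrE.
exact: (le_bigmax 0 (fun ij : 'I_1 * 'I_d => `|x ij.1 ij.2|) (0, j)).
Qed.

Lemma norm_coord (R : realType) (d : nat) (x : 'rV[R]_d) :
  x != 0 -> exists j, `|x| = `|x 0 j|.
Proof.
move=> x0; have /mx_norm_neq0 [[u j] /= xj] : mx_norm x != 0.
  by apply: contra x0 => /eqP/mx_norm_eq0 ->.
by exists j; rewrite -[LHS]/(mx_norm x) xj ord1.
Qed.

(** Each summand is comparable to [x_j ^ (2 q)]; the largest coordinate gives
    the lower bound. *)
Lemma elliptic_symbol_equiv (R : realType) (d q : nat) :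
  exists c C : R, [/\ 0 < c, 0 < C &
    \forall x \near (0 : 'rV[R]_d)^',
      c * (`|x| ^+ q) ^+ 2 <= elliptic_symbol q x <= C * (`|x| ^+ q) ^+ 2].
Proof.
have [e e0 cose] := two_sub_2cos_equiv R.
(* The factor [d.+1], rather than [d], keeps C positive when [d = 0]. *)
exists (4^-1 ^+ q), (d.+1%:R * 4 ^+ q); split.
- by rewrite exprn_gt0// invr_gt0.
- by rewrite mulr_gt0// ?ltr0n// exprn_gt0.
rewrite near_withinE; apply/nbhs_ballP; exists e => //= x.
rewrite mx_norm_ball /ball_ /= sub0r normrN => xe x0.
rewrite -exprM mulnC exprM -exprMn -mulrA -exprMn.
have bnd j : 0 <= 2 - 2 * cos (x 0 j) <= 4 * `|x| ^+ 2.
  have xj := coord_le_norm _ _ x j.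
  have /cose/andP[_ h] := le_lt_trans xj xe.
  apply/andP; split; first by have := cos_le1 (x 0 j); lra.
  rewrite (le_trans h)// ler_pM2l// -(real_normK (num_real (x 0 j))).
  by rewrite ler_pXn2r ?nnegrE.
apply/andP; split.
- have [j xj] := norm_coord _ _ x x0.
  rewrite /elliptic_symbol (bigD1 j)//= -[leLHS]addr0 lerD//; last first.
    by apply: sumr_ge0 => k _; apply: exprn_ge0; have /andP[] := bnd k.
  have /cose/andP[h _] : `|x 0 j| < e by rewrite -xj.
  have /andP[b0 _] := bnd j.
  rewrite lerXn2r ?nnegrE ?mulr_ge0 ?sqr_ge0 ?invr_ge0//.
  by rewrite xj real_normK ?num_real// mulrC.
- apply: (@le_trans _ _ (\sum_(j < d) (4 * `|x| ^+ 2) ^+ q)).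
    apply: ler_sum => j _; have /andP[b0 b1] := bnd j.
    by rewrite lerXn2r ?nnegrE ?mulr_ge0 ?sqr_ge0.
  rewrite sumr_const card_ord -[leLHS]mulr_natl.
  by rewrite ler_wpM2r ?exprn_ge0 ?mulr_ge0 ?sqr_ge0// ler_nat.
Qed.

(** * High frequency orders *)

Lemma limf_esup_lty (T : choiceType) (X : filteredType T) (R : realType)
    (h : X -> R) (F : set_system X) : Filter F ->
  (limf_esup (fun x => (h x)%:E) F < +oo)%E <->
  exists k, \forall x \near F, h x <= k.
Proof.
move=> FF; rewrite limf_esupE; split.
  move=> /ereal_inf_lt[_ [V FV <-]] supV.
  have le_sup x : V x -> ((h x)%:E <= ereal_sup [set (h x)%:E | x in V])%E.
    by move=> Vx; apply: ereal_sup_ubound; exists x.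
  move: supV le_sup; case: (ereal_sup _) => [s|//|] _ le_sup.
    by exists s; apply: filterS FV => x /le_sup; rewrite lee_fin.
  by exists 0; apply: filterS FV => x /le_sup.
move=> [k Fk]; apply: (@le_lt_trans _ _ k%:E); last exact: ltry.
apply: (@le_trans _ _ (ereal_sup [set (h x)%:E | x in [set x | h x <= k]])).
  by apply: ereal_inf_lbound; exists [set x | h x <= k].
by apply: ge_ereal_sup => _ [x /= hx <-]; rewrite lee_fin.
Qed.

Lemma hf_ordersP (R : realType) (d : nat) (g : 'rV[R]_d -> R[i]) (s : R) :
  hf_orders g s <-> 0 <= s /\ forall e : 'I_d -> bool, (exists j, e j) ->
    exists2 k : R, 0 < k & \forall x \near (0 : 'rV[R]_d)^',
      Normc.normc (g (mirror e x)) <= k * `|x| `^ s.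
Proof.
split=> -[s0 H]; split=> // e ej.
  have /eqO_exP[k k0 Hk] := H e ej; exists k => //.
  apply: filterS Hk => x; rewrite /= (ger0_norm (powR_ge0 _ _)).
  by apply: le_trans; exact: ler_norm.
have [k k0 Hk] := H e ej; apply/eqO_exP; exists k => //.
apply: filterS Hk => x; rewrite /= (ger0_norm (powR_ge0 _ _)).
by rewrite ger0_norm//; case: (g _) => a b; exact: sqrtr_ge0.
Qed.

Lemma hf_orders_proportional (R : realType) (d : nat) (g h : 'rV[R]_d -> R[i])
    (a : R) (s : R) :
  0 < a -> (forall x, Normc.normc (g x) = a * Normc.normc (h x)) ->
  hf_orders g s <-> hf_orders h s.
Proof.
move=> a0 gh; rewrite !hf_ordersP.
split=> -[s0 H]; split=> // e ej; have [k k0 Hk] := H e ej.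
- exists (a^-1 * k); first by rewrite mulr_gt0// invr_gt0.
  by apply: filterS Hk => x; rewrite gh -mulrA ler_pdivlMl.
- exists (a * k); first by rewrite mulr_gt0.
  by apply: filterS Hk => x; rewrite gh -mulrA ler_pM2l.
Qed.

(** On the unit ball [|x| ^ t <= |x| ^ s] when [s <= t]. *)
Lemma hf_orders_le (R : realType) (d : nat) (g : 'rV[R]_d -> R[i]) (s t : R) :
  0 <= s -> s <= t -> hf_orders g t -> hf_orders g s.
Proof.
rewrite !hf_ordersP => s0 st [_ H]; split=> // e ej.
have [k k0 Hk] := H e ej; exists k => //.
have : \forall x \near (0 : 'rV[R]_d)^', `|x| <= 1 /\ x != 0.
  rewrite near_withinE; apply/nbhs_ballP; exists 1 => //= x.
  by rewrite mx_norm_ball /ball_ /= sub0r normrN => /ltW.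
move: Hk; apply: filterS2 => x Hk [x1 x0]; apply: (le_trans Hk).
rewrite ler_pM2l//; apply: ger_powR => //.
by rewrite normr_gt0 x0.
Qed.

(** Since f is comparable to [|x| ^ (2 q)], boundedness of [|g(y)|^2 / f(x)]
    says that [|g(y)| = O(|x| ^ q)]. *)
Lemma hf_orders_limsup (R : realType) (d q : nat) (g : 'rV[R]_d -> R[i]) :
  hf_orders g q%:R <->
  (forall e : 'I_d -> bool, (exists j, e j) ->
     (limf_esup
        (fun x : 'rV[R]_d =>
           (Normc.normc (g (mirror e x) ^+ 2 / (elliptic_symbol q x)%:C)%R)%:E)
        ((0 : 'rV[R]_d)^')%R < +oo)%E).
Proof.
have [c [C [c0 C0 fcC]]] := elliptic_symbol_equiv R d q.
have normE e (x : 'rV[R]_d) :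
    Normc.normc (g (mirror e x) ^+ 2 / (elliptic_symbol q x)%:C) =
    Normc.normc (g (mirror e x)) ^+ 2 / elliptic_symbol q x.
  rewrite Normc.normcM Normc.normcV expr2 Normc.normcM -expr2; congr (_ / _).
  by rewrite /= expr0n addr0 sqrtr_sqr ger0_norm// elliptic_symbol_ge0.
have ng0 (z : R[i]) : 0 <= Normc.normc z by case: z => a b; exact: sqrtr_ge0.
have nz : \forall x \near (0 : 'rV[R]_d)^', x != 0 by apply: withinT.
rewrite hf_ordersP; split.
- move=> [_ H] e ej; have [k k0 Hk] := H e ej.
  apply/limf_esup_lty; exists (k ^+ 2 / c).
  move: fcC; apply: filterS2 (filterI Hk nz) => x [Hx x0] /andP[fc _].
  have xq0 : 0 < (`|x| ^+ q) ^+ 2 by rewrite !exprn_gt0// normr_gt0.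
  have f0 : 0 < elliptic_symbol q x by apply: lt_le_trans fc; rewrite mulr_gt0.
  rewrite normE ler_pdivrMr// -mulrA.
  apply: (@le_trans _ _ (k ^+ 2 * (`|x| ^+ q) ^+ 2)).
    rewrite -exprMn lerXn2r ?nnegrE ?mulr_ge0 ?(ltW k0) ?exprn_ge0//.
    by move: Hx; rewrite powR_mulrn.
  by rewrite ler_pM2l ?exprn_gt0// ler_pdivlMl.
- move=> H; split=> // e ej.
  have /limf_esup_lty[k Hk] := H e ej.
  (* The bound k on the limit superior comes without a sign, hence the maximum;
     adding 1 below makes the constant of the O positive. *)
  pose k1 := Num.max k 0 * C; have k10 : 0 <= k1.
    by rewrite mulr_ge0 ?(ltW C0)// le_max lexx orbT.
  exists (Num.sqrt k1 + 1); first by rewrite ltr_wpDl// sqrtr_ge0.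
  move: fcC; apply: filterS2 (filterI Hk nz) => x [Hx x0] /andP[fc fC].
  have xq0 : 0 < (`|x| ^+ q) ^+ 2 by rewrite !exprn_gt0// normr_gt0.
  have f0 : 0 < elliptic_symbol q x by apply: lt_le_trans fc; rewrite mulr_gt0.
  rewrite powR_mulrn//.
  apply: (@le_trans _ _ (Num.sqrt k1 * `|x| ^+ q)); last first.
    by rewrite ler_wpM2r ?exprn_ge0// lerDl.
  rewrite -ler_sqr ?nnegrE ?mulr_ge0 ?sqrtr_ge0 ?exprn_ge0//.
  rewrite exprMn sqr_sqrtr// /k1 -mulrA.
  move: Hx; rewrite normE ler_pdivrMr// => /le_trans; apply.
  apply: (@le_trans _ _ (Num.max k 0 * elliptic_symbol q x)).
    by rewrite ler_wpM2r ?(ltW f0)// le_max lexx.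
  by rewrite ler_wpM2l// le_max lexx orbT.
Qed.

Theorem proposition4 (R : realType) (d q : nat) (hd : (1 <= d)%N) (hq : (1 <= q)%N)
    (p r : 'rV[R]_d -> R[i])
    (hp : trigpoly p) (hr : trigpoly r)
    (hp0 : exists x, p x != 0) (hr0 : exists x, r x != 0)
    (hpr : forall a : d.-tuple nat, (forall i, (1 <= tnth a i)%N) ->
       let n := [seq (2 ^ k)%N | k <- a] in
       prolongation n p = (restriction n (fun x => 2 ^+ d * r x)) ^t*)
    (gamma_p gamma_r : R)
    (hgp : hf_prolongation p gamma_p) (hgr : hf_restriction r gamma_r) :
  ((2 * q)%:R <= gamma_r + gamma_p)
  <->
  (forall e : 'I_d -> bool, (exists j, e j) ->
     (limf_esup
        (fun x : 'rV[R]_d =>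
           (Normc.normc (p (mirror e x) ^+ 2 / (elliptic_symbol q x)%:C)%R)%:E)
        ((0 : 'rV[R]_d)^')%R < +oo)%E).
Proof.
have pr x : p x = (2 ^+ d * r x)^*.
  apply: prolongation_adjoint_symbol hp (trigpolyZ _ _ hr) _ x => m n.
  have := hpr (nseq_tuple d m.+1); rewrite /= map_nseq; apply => k.
  by rewrite (tnth_nth 0%N) /= nth_nseq ltn_ord.
have two0 : (2 : R[i]) ^+ d != 0 by rewrite expf_neq0// pnatr_eq0.
have phalf x : p x / 2 ^+ d = (r x)^*.
  by rewrite pr rmorphM rmorphXn rmorph_nat mulrAC divff// mul1r.
have hf_pr s : hf_orders (fun x => p x / 2 ^+ d) s <-> hf_orders r s.
  apply: (hf_orders_proportional _ _ _ _ 1) => // x.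
  by rewrite phalf normc_conjc mul1r.
have hf_p s : hf_orders (fun x => p x / 2 ^+ d) s <-> hf_orders p s.
  apply: (hf_orders_proportional _ _ _ _ (Normc.normc (2 ^+ d)^-1)) => [|x].
    rewrite lt_neqAle eq_sym; apply/andP; split; last first.
      by case: (_^-1) => a b; exact: sqrtr_ge0.
    by apply/eqP => /Normc.eq0_normc/eqP; rewrite invr_eq0 (negPf two0).
  by rewrite Normc.normcM mulrC.
case: hgp hgr => hp1 hp2 [hr1 hr2].
have -> : gamma_r = gamma_p.
  by apply/eqP; rewrite eq_le hp2 ?hr2//; [exact/hf_pr|exact/hf_pr].
rewrite -hf_orders_limsup -hf_p natrM mulr_natl -mulr2n ler_pMn2r//; split.
- by move=> qg; apply: hf_orders_le qg hp1.
- exact: hp2.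
Qed.
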